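(* Let $n\ge1$, $\beta\in(0,\infty)$, let $C\in\mathbb{R}^{n\times n}$ be symmetric and let $\mathbf{b}\in\mathbb{R}^n$ have strictly positive entries. For $\boldsymbol\lambda\in\mathbb{R}^n$ define $$X(\boldsymbol\lambda)=e^{-\beta(C-\mathrm{diag}(\boldsymbol\lambda))},\qquad g(\boldsymbol\lambda)=\mathbf{b}\cdot\boldsymbol\lambda-\beta^{-1}\mathrm{Tr}\left[e^{-\beta(C-\mathrm{diag}(\boldsymbol\lambda))}\right],$$ and let $\boldsymbol\lambda^\star$ denote the maximizer of $g$ over $\mathbb{R}^n$. Given $\boldsymbol\lambda^0\in\mathbb{R}^n$, define $$\boldsymbol\lambda^1=\boldsymbol\lambda^0+\beta^{-1}\left(\log\mathbf{b}-\log\mathrm{diag}\left[X(\boldsymbol\lambda^0)\right]\right),$$ $$g^0(\boldsymbol\lambda)=\mathbf{b}\cdot\boldsymbol\lambda-\beta^{-1}\mathrm{Tr}\left[e^{\beta\,\mathrm{diag}(\boldsymbol\lambda-\boldsymbol\lambda^0)}e^{-\beta(C-\mathrm{diag}(\boldsymbol\lambda^0))}\right].$$ Then: (1) $g^0$ is strictly concave on $\mathbb{R}^n$; (2) $g^0(\boldsymbol\lambda)\le g(\boldsymbol\lambda)$ for all $\boldsymbol\lambda\in\mathbb{R}^n$, and $g^0(\boldsymbol\lambda^0)=g(\boldsymbol\lambda^0)$; (3) $\boldsymbol\lambda^1=\mathrm{argmax}_{\boldsymbol\lambda\in\mathbb{R}^n}\,g^0(\boldsymbol\lambda)$; (4)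 $\boldsymbol\lambda^1=\boldsymbol\lambda^0$ if and only if $\boldsymbol\lambda^0=\boldsymbol\lambda^\star$. Consequently $g(\boldsymbol\lambda^1)\ge g(\boldsymbol\lambda^0)$, and $g(\boldsymbol\lambda^1)>g(\boldsymbol\lambda^0)$ unless $\boldsymbol\lambda^0=\boldsymbol\lambda^\star$.
   Context: For a vector $\mathbf{v}\in\mathbb{R}^n$, $\mathrm{diag}(\mathbf{v})$ is the diagonal matrix with diagonal $\mathbf{v}$; for a square matrix $M$, $\mathrm{diag}[M]$ is the vector of its diagonal entries. The logarithm of a vector with positive entries is taken entrywise. The function $g$ is the dual objective of the entropically regularized semidefinite program: minimize $\mathrm{Tr}[CX]+\beta^{-1}\mathrm{Tr}[X\log X-X]$ over symmetric positive definite $X\in\mathbb{R}^{n\times n}$ subject to $\mathrm{diag}[X]=\mathbf{b}$. The map $\boldsymbol\lambda^0\mapsto\boldsymbol\lambda^1$ is called the noncommutative matrix scaling update. *)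

(* Defs.v *)
From HB Require Import structures.
From mathcomp Require Import all_boot all_order all_algebra.
From mathcomp Require Import all_classical all_reals all_analysis.
Set Implicit Arguments.
Unset Strict Implicit.
Unset Printing Implicit Defensive.
Import Order.TTheory GRing.Theory Num.Theory.
Import numFieldNormedType.Exports.
Local Open Scope classical_set_scope.
Local Open Scope ring_scope.

(* Sum of the exponential power series, in the (entrywise) topology of
   'M[R]_n. *)
Definition expm (R : realType) (n : nat) (A : 'M[R]_n) : 'M[R]_n :=
  lim (series (fun k : nat => (k`!%:R)^-1 *: A ^+ k : 'M[R]_n) @ \oo).

(* diag[M]; the converse operation diag(v) is diag_mx v. *)
Definition diag_of (R : realType) (n : nat) (M : 'M[R]_n) : 'rV[R]_n :=
  \row_i M i i.

Definition dot (R : realType) (n : nat) (u v : 'rV[R]_n) : R :=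
  \sum_(i < n) u 0 i * v 0 i.

Definition strictly_concave (R : realType) (n : nat) (f : 'rV[R]_n -> R) :
    Prop :=
  forall (x y : 'rV[R]_n) (t : R), x != y -> 0 < t -> t < 1 ->
    t * f x + (1 - t) * f y < f (t *: x + (1 - t) *: y).

(* The set of all global maximizers; argmax f = [set x] says that x is the
   unique one. *)
Definition argmax (R : realType) (T : Type) (f : T -> R) : set T :=
  [set x | forall y, f y <= f x].

Definition X (R : realType) (n : nat) (beta : R) (C : 'M[R]_n)
    (l : 'rV[R]_n) : 'M[R]_n :=
  expm (- beta *: (C - diag_mx l)).

Definition g (R : realType) (n : nat) (beta : R) (C : 'M[R]_n)
    (b l : 'rV[R]_n) : R :=
  dot b l - beta^-1 * \tr (expm (- beta *: (C - diag_mx l))).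

(* The minorizing function g^0 built at the point l0. *)
Definition g0 (R : realType) (n : nat) (beta : R) (C : 'M[R]_n)
    (b l0 l : 'rV[R]_n) : R :=
  dot b l - beta^-1 * \tr (expm (beta *: diag_mx (l - l0)) *m
                           expm (- beta *: (C - diag_mx l0))).

(* The noncommutative matrix scaling update; map_mx ln is the entrywise log. *)
Definition scaling_update (R : realType) (n : nat) (beta : R) (C : 'M[R]_n)
    (b l0 : 'rV[R]_n) : 'rV[R]_n :=
  l0 + beta^-1 *: (map_mx (@ln R) b - map_mx (@ln R) (diag_of (X beta C l0))).

(* Main.v *)
(** For symmetric H, A with eigenbases (u_j, h_j), (v_k, a_k), a trace such as
    Tr[H e^A] is the sum over j, k of <u_j, v_k>^2 h_j e^(a_k).  Applied to the
    tangent inequality of exp this gives Klein's inequality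
    Tr e^H > Tr e^A + Tr[(H - A) e^A] for H <> A, hence strict concavity of g
    in tangent form, its coercivity (compare with the diagonal part), and the
    fact that a fixed point of the update, where diag X = b, is the strict
    maximizer.

    The minorization g0 <= g is the Golden-Thompson inequality
    Tr e^(A + D) <= Tr[e^D e^A] for diagonal D.  With rho = e^(A + D) and
    sigma = e^A, the relative entropy of rho with respect to sigma is
    Tr[rho D].  It dominates the relative entropy of the diagonals,
    sum_i rho_ii ln (rho_ii / sigma_ii), and x ln (x / y) >= x - y with
    x = rho_ii, y = sigma_ii e^(D_i) concludes.  The comparison of entropies is
    obtained by integrating, over t, a comparison of sums of r^2 / (s + t r)
    that is a weighted AM-GM inequality.

    A maximizer of g maximizes the minorant g0 built at that point, hence is
    fixed by the update; no derivative of g is needed. *)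

Require Import Defs.
From HB Require Import structures.
From mathcomp Require Import all_boot all_order all_algebra.
From mathcomp Require Import all_classical all_reals all_analysis.
From mathcomp Require Import ring lra complex.
Set Implicit Arguments.
Unset Strict Implicit.
Unset Printing Implicit Defensive.
Import Order.TTheory GRing.Theory Num.Theory.
Import numFieldNormedType.Exports.
Local Open Scope classical_set_scope.
Local Open Scope ring_scope.

(** * The real spectral theorem *)

(** With [w] the conjugate transpose of [v], evaluating [v A w] both ways gives
    [a (v w) = conj(a) (v w)], and [v w], the sum of the |v_j|^2, is nonzero. *)
Lemma sym_eigenvalue_real (R : realType) (n : nat) (A : 'M[R]_n)
    (v : 'rV[complex R]_n) (a : complex R) :
  A^T = A -> v != 0 -> v *m map_mx (real_complex R) A = a *: v ->
  a = (complex.Re a)%:C%C.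
Proof.
move=> As v0 vA.
pose w := map_mx Num.conj v^T.
have wA : map_mx (real_complex R) A *m w = a^* *: w.
  rewrite -[a^* *: w]/(_ *: map_mx Num.conj v^T).
  have -> : a^* *: map_mx Num.conj v^T = map_mx Num.conj (a *: v)^T.
    by apply/matrixP => i j; rewrite !mxE rmorphM.
  rewrite -vA trmx_mul map_mxM map_trmx As; congr (_ *m _).
  by apply/matrixP => i j; rewrite !mxE; apply/esym/CrealP; rewrite complex_real.
have : a *: (v *m w) = a^* *: (v *m w).
  by rewrite scalemxAl -vA -mulmxA wA scalemxAr.
move/matrixP/(_ 0 0); rewrite !mxE => e.
have /eqP : (a - a^*) * \sum_j v 0 j * w j 0 = 0 by rewrite mulrBl e subrr.
rewrite mulf_eq0 => /orP[|].
  rewrite subr_eq0 => /eqP; case: a {vA wA e} => x y /= [].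
  move=> yN; have -> : y = 0 by lra.
  by [].
move=> /eqP s0; case/negP: v0; apply/eqP/rowP => j; rewrite mxE; apply/eqP.
have s_ge0 k : true -> 0 <= v 0 k * w k 0.
  by move=> _; rewrite !mxE mul_conjC_ge0.
have := @psumr_eq0P _ _ _ _ s_ge0 s0 j isT; rewrite !mxE => /eqP.
by rewrite mul_conjC_eq0.
Qed.

(** [B] is the matrix of [A] restricted to the row space of [K]. It need not be symmetric, but its
    complex eigenvectors lift through [K] to eigenvectors of [A], so its eigenvalues are real. *)
Lemma sym_stable_eigenvector (R : realType) (n r : nat) (A : 'M[R]_n)
    (K : 'M[R]_(r, n)) :
  A^T = A -> (0 < r)%N -> row_free K -> stablemx K A ->
  exists (u : 'rV[R]_n) (a : R), [/\ u != 0, (u <= K)%MS & u *m A = a *: u].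
Proof.
move=> As r0 Kf /submxP[B KA].
have [a /eigenvalueP[v vB v0]] := eigenvalue_closed (map_mx (real_complex R) B) r0.
have aR : a = (complex.Re a)%:C%C.
  apply: (@sym_eigenvalue_real _ _ A (v *m map_mx (real_complex R) K)) => //.
    by rewrite mulmx_free_eq0 // row_free_map.
  by rewrite -mulmxA -map_mxM KA map_mxM mulmxA vB scalemxAl.
(* The characteristic polynomial of [B] has real coefficients, so this real number is one of its
   roots over [R] and has a real eigenvector. *)
have /eigenvalueP[w wB w0] : eigenvalue B (complex.Re a).
  rewrite eigenvalue_root_char -(fmorph_root (real_complex R)) /= map_char_poly.
  rewrite -eigenvalue_root_char; apply/eigenvalueP; exists v => //.
  by rewrite -aR.
exists (w *m K), (complex.Re a); split; rewrite ?submxMl ?mulmx_free_eq0 //.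
by rewrite -mulmxA KA mulmxA wB scalemxAl.
Qed.

(** Orthonormal eigenvectors are collected as rows, one at a time: by symmetry the orthogonal
    complement of the rows found so far is stable under [A], and it is nonzero as long as there are
    fewer than [n] of them. *)
Lemma sym_eigenbasis_extend (R : realType) (n m : nat) (A : 'M[R]_n) :
  A^T = A -> (m <= n)%N ->
  exists (P : 'M[R]_(m, n)) (d : 'rV[R]_m),
    P *m P^T = 1%:M /\ P *m A = diag_mx d *m P.
Proof.
move=> As; elim: m => [_|m IH mn].
  by exists 0, 0; split; apply/matrixP => -[].
have [P [d [PP PA]]] := IH (ltnW mn).
have [] := @sym_stable_eigenvector _ _ _ A (row_base (kermx P^T)) As.
- rewrite mxrank_ker mxrank_tr subn_gt0 (leq_ltn_trans _ mn) //.
  exact: rank_leq_row.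
- exact: row_base_free.
- rewrite stablemx_row_base; apply/sub_kermxP.
  rewrite -mulmxA -[X in X *m P^T]As -trmx_mul PA trmx_mul mulmxA.
  by rewrite mulmx_ker mul0mx.
move=> u [a [u0]]; rewrite eq_row_base => /sub_kermxP uP uA.
pose c := Num.sqrt (\sum_j u 0 j ^+ 2).
have s_gt0 : 0 < \sum_j u 0 j ^+ 2.
  rewrite lt_neqAle sumr_ge0 ?andbT; last by move=> *; exact: sqr_ge0.
  apply: contraNneq u0 => /esym s0; apply/eqP/rowP => j; rewrite mxE.
  have s_ge0 k : true -> 0 <= u 0 k ^+ 2 by move=> _; exact: sqr_ge0.
  by have /eqP := @psumr_eq0P _ _ _ _ s_ge0 s0 j isT; rewrite sqrf_eq0 => /eqP.
have uu : u *m u^T = (c ^+ 2)%:M.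
  apply/matrixP => i j; rewrite !ord1 sqr_sqrtr ?ltW // !mxE eqxx mulr1n.
  by apply: eq_bigr => k _; rewrite !mxE expr2.
have c0 : c != 0 by rewrite gt_eqF // sqrtr_gt0.
rewrite -addn1; exists (col_mx P (c^-1 *: u)), (row_mx d a%:M); split.
  rewrite tr_col_mx mul_col_row PP !linearZ /= -!scalemxAl uP.
  rewrite -[P *m u^T]trmxK trmx_mul trmxK uP trmx0 !scaler0 uu.
  rewrite !scale_scalar_mx.
  by rewrite (_ : c^-1 * _ = 1) -?scalar_mx_block //; field.
rewrite mul_col_mx PA -scalemxAl uA diag_mx_row mul_block_col !mul0mx addr0 add0r.
congr col_mx; rewrite scalerA mulrC -scalerA; apply/matrixP => i j.
by rewrite mul_diag_mx !mxE !ord1 eqxx mulr1n.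
Qed.

Lemma sym_spectral (R : realType) (n : nat) (A : 'M[R]_n) :
  A^T = A ->
  exists (P : 'M[R]_n) (d : 'rV[R]_n),
    P *m P^T = 1%:M /\ A = P^T *m diag_mx d *m P.
Proof.
move=> /sym_eigenbasis_extend/(_ (leqnn n))[P [d [PP PA]]].
exists P, d; split => //.
by rewrite -mulmxA -PA mulmxA (mulmx1C PP) mul1mx.
Qed.

(** * Exponentials of symmetric matrices *)

Lemma cvg_mx (R : realType) (m n : nat) (u : nat -> 'M[R]_(m, n))
    (M : 'M[R]_(m, n)) :
  (forall i j, u k i j @[k --> \oo] --> M i j) -> u @ \oo --> M.
Proof.
move=> uM; apply/cvg_mx_entourageP => E entE.
apply: filter_forall => i; apply: filter_forall => j.
have /cvg_app_entourageP/(_ E entE) := uM i j.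
by apply: filterS => k Ek; apply/mem_set.
Qed.

Lemma conj_diag_exp (R : realType) (n k : nat) (P : 'M[R]_n) (d : 'rV[R]_n) :
  P *m P^T = 1%:M ->
  (P^T *m diag_mx d *m P) ^+ k = P^T *m diag_mx (map_mx (@GRing.exp R ^~ k) d) *m P.
Proof.
move=> PP; elim: k => [|k IH].
  rewrite expr0 (_ : diag_mx _ = 1%:M) ?mulmx1 ?(mulmx1C PP) //.
  by apply/matrixP => i j; rewrite !mxE expr0.
rewrite exprS IH -[LHS]/(_ *m _) !mulmxA.
rewrite -(mulmxA _ P P^T) PP mulmx1 -(mulmxA P^T).
congr (_ *m _ *m _); rewrite mulmx_diag; congr diag_mx.
by apply/rowP => i; rewrite !mxE exprS.
Qed.

(** Each entry of a partial sum is a combination, with fixed coefficients [P l i * P l j], of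
    partial sums of scalar exponentials. *)
Lemma expm_conj_diag (R : realType) (n : nat) (P : 'M[R]_n) (d : 'rV[R]_n) :
  P *m P^T = 1%:M ->
  expm (P^T *m diag_mx d *m P) = P^T *m diag_mx (map_mx expR d) *m P.
Proof.
move=> PP; apply/cvg_lim => //; apply: cvg_mx => i j.
have -> : (fun k => series (fun k : nat => (k`!%:R)^-1 *:
    (P^T *m diag_mx d *m P) ^+ k) k i j) =
    (fun k => \sum_l P l i * P l j * series (exp_coeff (d 0 l)) k).
  apply/funext => k; rewrite /series /= summxE.
  under [RHS]eq_bigr do rewrite mulr_sumr.
  rewrite exchange_big; apply: eq_bigr => p _ /=.
  rewrite conj_diag_exp // !mxE mulr_sumr; apply: eq_bigr => l _.
  by rewrite mul_mx_diag !mxE /exp_coeff /=; ring.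
rewrite !mxE; under eq_bigr do rewrite mul_mx_diag !mxE mulrAC.
apply: cvg_big => [|l _]; [exact: add_continuous|]; apply: cvgMl_tmp.
exact: is_cvg_series_exp_coeff.
Qed.

Lemma expm_diag (R : realType) (n : nat) (d : 'rV[R]_n) :
  expm (diag_mx d) = diag_mx (map_mx expR d).
Proof.
have := @expm_conj_diag R n 1%:M d; rewrite trmx1 !mulmx1 !mul1mx; exact.
Qed.

(** * Klein's inequality *)

Lemma trace_diag_mul2 (R : comNzRingType) (n : nat) (r s : 'rV[R]_n)
    (U V : 'M[R]_n) :
  \tr (diag_mx r *m U *m diag_mx s *m V^T) =
  \sum_j \sum_k r 0 j * s 0 k * (U j k * V j k).
Proof.
apply: eq_bigr => j _; rewrite !mxE; apply: eq_bigr => k _.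
by rewrite mul_mx_diag mul_diag_mx !mxE; ring.
Qed.

Lemma trace_conj_diag2 (R : comNzRingType) (n : nat) (P Q : 'M[R]_n)
    (r s : 'rV[R]_n) :
  \tr ((P^T *m diag_mx r *m P) *m (Q^T *m diag_mx s *m Q)) =
  \sum_j \sum_k r 0 j * s 0 k * (P *m Q^T) j k ^+ 2.
Proof.
under eq_bigr do under eq_bigr do rewrite expr2.
rewrite -trace_diag_mul2 trmx_mul trmxK -!mulmxA mxtrace_mulC.
by rewrite !mulmxA.
Qed.

Lemma conj_diag1 (R : comNzRingType) (n : nat) (P : 'M[R]_n) :
  P *m P^T = 1%:M -> P^T *m diag_mx (const_mx 1) *m P = 1%:M.
Proof. by move=> PP; rewrite diag_const_mx mulmx1 (mulmx1C PP). Qed.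

(** Inserting the identity as [Q^T diag(1) Q] puts this trace on the same weights
    [(P *m Q^T) j k ^+ 2] as a trace of two matrices, so that both can be compared termwise. *)
Lemma trace_conj_diagl (R : comNzRingType) (n : nat) (P Q : 'M[R]_n)
    (r : 'rV[R]_n) : Q *m Q^T = 1%:M ->
  \tr (P^T *m diag_mx r *m P) = \sum_j \sum_k r 0 j * (P *m Q^T) j k ^+ 2.
Proof.
move=> QQ; rewrite -[LHS]/(\tr _) -[P^T *m _ *m P]mulmx1 -(conj_diag1 QQ).
rewrite trace_conj_diag2; apply: eq_bigr => j _; apply: eq_bigr => k _.
by rewrite mxE mulr1.
Qed.

Lemma trace_conj_diagr (R : comNzRingType) (n : nat) (P Q : 'M[R]_n)
    (s : 'rV[R]_n) : P *m P^T = 1%:M ->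
  \tr (Q^T *m diag_mx s *m Q) = \sum_j \sum_k s 0 k * (P *m Q^T) j k ^+ 2.
Proof.
move=> PP; rewrite -[Q^T *m _ *m Q]mul1mx -(conj_diag1 PP).
rewrite trace_conj_diag2; apply: eq_bigr => j _; apply: eq_bigr => k _.
by rewrite mxE mul1r.
Qed.

Lemma expR_tangent_gt (R : realType) (x y : R) :
  x != y -> expR y + (x - y) * expR y < expR x.
Proof.
move=> xy; have /expR_gt1Dx : x - y != 0 by rewrite subr_eq0.
rewrite -(ltr_pM2r (expR_gt0 y)) -expRD subrK; lra.
Qed.

Lemma expR_tangent_ge (R : realType) (x y : R) :
  expR y + (x - y) * expR y <= expR x.
Proof.
have [->|/expR_tangent_gt/ltW//] := eqVneq x y.
by rewrite subrr mul0r addr0.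
Qed.

(** On common weights, the defect in Klein's inequality is a weighted sum of defects in the scalar
    tangent inequality of exp. *)
Lemma trace_expm_conj_diagB (R : realType) (n : nat) (P Q : 'M[R]_n)
    (h a : 'rV[R]_n) : P *m P^T = 1%:M -> Q *m Q^T = 1%:M ->
  let H := P^T *m diag_mx h *m P in let A := Q^T *m diag_mx a *m Q in
  \tr (expm H) - (\tr (expm A) + \tr ((H - A) *m expm A)) =
  \sum_j \sum_k (expR (h 0 j) - (expR (a 0 k) +
      (h 0 j - a 0 k) * expR (a 0 k))) * (P *m Q^T) j k ^+ 2.
Proof.
move=> PP QQ H A; rewrite /H /A !expm_conj_diag // mulmxBl linearB /=.
rewrite trace_conj_diag2 (trace_conj_diagl _ _ QQ) (trace_conj_diagr _ _ PP).
rewrite [X in _ + (_ - X)](_ : _ =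
    \sum_j \sum_k a 0 k * expR (a 0 k) * (P *m Q^T) j k ^+ 2).
  rewrite -!(sumrB, big_split) /=; apply: eq_bigr => j _.
  rewrite -!(sumrB, big_split) /=; apply: eq_bigr => k _.
  by rewrite !mxE; ring.
rewrite !mulmxA -(mulmxA _ Q) QQ mulmx1 -(mulmxA Q^T) mulmx_diag.
rewrite (trace_conj_diagr _ _ PP).
by apply: eq_bigr => j _; apply: eq_bigr => k _; rewrite !mxE.
Qed.

Lemma trace_expm_tangent_ge (R : realType) (n : nat) (A H : 'M[R]_n) :
  A^T = A -> H^T = H ->
  \tr (expm A) + \tr ((H - A) *m expm A) <= \tr (expm H).
Proof.
move=> /sym_spectral[Q [a [QQ ->]]] /sym_spectral[P [h [PP ->]]].
rewrite -subr_ge0 trace_expm_conj_diagB //.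
apply: sumr_ge0 => j _; apply: sumr_ge0 => k _; rewrite mulr_ge0 ?sqr_ge0 //.
by rewrite subr_ge0 expR_tangent_ge.
Qed.

(** In the equality case every term vanishes, so [h_j = a_k] wherever [(P *m Q^T) j k] is nonzero.
    Then [P *m Q^T] intertwines the two diagonal matrices, which forces [H = A]. *)
Lemma trace_expm_tangent_gt (R : realType) (n : nat) (A H : 'M[R]_n) :
  A^T = A -> H^T = H -> H != A ->
  \tr (expm A) + \tr ((H - A) *m expm A) < \tr (expm H).
Proof.
move=> As Hs HA; rewrite lt_neqAle trace_expm_tangent_ge // andbT.
apply: contraNneq HA; move: As Hs.
move=> /sym_spectral[Q [a [QQ ->]]] /sym_spectral[P [h [PP ->]]].
move/esym/eqP; rewrite -subr_eq0 trace_expm_conj_diagB // => /eqP s0.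
have F_ge0 j k : 0 <= (expR (h 0 j) - (expR (a 0 k) +
    (h 0 j - a 0 k) * expR (a 0 k))) * (P *m Q^T) j k ^+ 2.
  by rewrite mulr_ge0 ?sqr_ge0 // subr_ge0 expR_tangent_ge.
have G_ge0 j : true -> 0 <= \sum_k (expR (h 0 j) - (expR (a 0 k) +
    (h 0 j - a 0 k) * expR (a 0 k))) * (P *m Q^T) j k ^+ 2.
  by move=> _; apply: sumr_ge0.
have com : diag_mx h *m (P *m Q^T) = (P *m Q^T) *m diag_mx a.
  apply/matrixP => j k; rewrite mul_mx_diag mul_diag_mx !mxE -/((P *m Q^T) j k).
  have /eqP := @psumr_eq0P _ _ _ _ (fun k _ => F_ge0 j k)
    (@psumr_eq0P _ _ _ _ G_ge0 s0 j isT) k isT.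
  rewrite mulf_eq0 sqrf_eq0 mxE => /orP[|/eqP ->]; last by rewrite mulr0 mul0r.
  have [->|/expR_tangent_gt] := eqVneq (h 0 j) (a 0 k).
    by move=> _; rewrite mulrC.
  by move=> lt; rewrite subr_eq0 gt_eqF.
have -> : diag_mx h = P *m Q^T *m diag_mx a *m (Q *m P^T).
  by rewrite -com -!mulmxA (mulmxA Q^T) (mulmx1C QQ) mul1mx PP mulmx1.
by rewrite !mulmxA (mulmx1C PP) mul1mx -!mulmxA (mulmx1C PP) mulmx1.
Qed.

(** * The Golden-Thompson inequality *)

(* Along the segment from x to y, the derivative of the weighted sum of
   logarithms at theta is (1 + t)^2 times the sum assumed nonnegative at
   t = theta / (1 - theta), because the weights sum to 0. *)
Lemma sum_ln_ge0 (R : realType) (I : finType) (c x y : I -> R) :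
  (forall i, 0 < x i) -> (forall i, 0 < y i) -> \sum_i c i = 0 ->
  (forall t : R, 0 <= t -> 0 <= \sum_i c i * y i / (x i + t * y i)) ->
  0 <= \sum_i c i * (ln (y i) - ln (x i)).
Proof.
move=> x0 y0 c0 ct.
pose z i (u : R) := x i + u * (y i - x i).
have z0 i (u : R) : 0 <= u <= 1 -> 0 < z i u.
  move=> /andP[u0 u1]; rewrite (_ : z i u = (1 - u) * x i + u * y i); last first.
    by rewrite /z; ring.
  have [->|un0] := eqVneq u 0; first by rewrite subr0 mul1r mul0r addr0.
  rewrite ltr_wpDl ?mulr_ge0 ?subr_ge0 // ?(ltW (x0 i)) //.
  by rewrite mulr_gt0 // lt_neqAle eq_sym un0.
pose F u := \sum_i c i * ln (z i u).
pose dF u := \sum_i c i * ((y i - x i) / z i u).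
have dFE (u : R) : 0 <= u <= 1 -> is_derive u 1 F (dF u).
  move=> u01.
  have -> : F = \sum_i (fun v => c i * ln (z i v)).
    by apply/funext => v; rewrite fct_sumE.
  apply: (big_ind2 (fun f df => is_derive u 1 f df)) => [||i _].
  - exact: is_derive_cst.
  - by move=> *; exact: is_deriveD.
  have zi0 := z0 i u u01.
  have dz : is_derive u 1 (z i) (y i - x i).
    rewrite /z; apply: is_derive_eq; by rewrite /GRing.scale /=; ring.
  have dl := is_derive1_ln zi0.
  have := is_derive1_comp dl dz => dc.
  rewrite (_ : (fun v => _) = c i *: (@ln R \o z i)) //.
  by apply: is_derive_eq; rewrite /GRing.scale /=; ring.
have [u u01||u] := @MVT R F dF 0 1 ltr01.
- by apply: dFE; move: u01; rewrite in_itv /= => /andP[??]; rewrite !ltW.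
- apply: derivable_within_continuous => u; rewrite in_itv /= => u01.
  by have [] := dFE u u01.
rewrite in_itv /= subr0 mulr1 => /andP[u0 u1] FE.
have -> : \sum_i c i * (ln (y i) - ln (x i)) = F 1 - F 0.
  rewrite /F -sumrB; apply: eq_bigr => i _.
  by rewrite /z mul1r mul0r addr0 addrCA subrr addr0 mulrBr.
have v0 : 0 < 1 - u by rewrite subr_gt0.
pose t := u / (1 - u).
have t0 : 0 <= t by rewrite divr_ge0 ?ltW.
(* Since [z i u = (1 - u) * (x i + t * y i)], each quotient [(y i - x i) / z i u] is a multiple of
   [y i / (x i + t * y i)] minus [(1 - u)^-1], a constant independent of [i]. *)
have -> : F 1 - F 0 = (1 - u)^-2 * \sum_i c i * y i / (x i + t * y i)
    - (1 - u)^-1 * \sum_i c i.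
  rewrite FE !mulr_sumr -sumrB; apply: eq_bigr => i _.
  have zi0 : 0 < z i u by rewrite z0 // !ltW.
  have xt0 : 0 < x i + t * y i by rewrite ltr_pwDl // mulr_ge0 // ltW.
  have -> : z i u = (1 - u) * (x i + t * y i).
    by rewrite /z /t; field; rewrite gt_eqF.
  rewrite /t; field; rewrite gt_eqF //=.
  rewrite (_ : _ + _ = (1 - u) * (x i + t * y i)) ?mulf_neq0 ?gt_eqF //.
  by rewrite /t; field; rewrite gt_eqF.
by rewrite c0 mulr0 subr0 mulr_ge0 ?ct // invr_ge0 sqr_ge0.
Qed.

(** Completing the square: multiplied by [w], the difference is [(r * m - w * y) ^+ 2]. *)
Lemma amgm_frac (R : realFieldType) (w m r y : R) : 0 < w ->
  2 * r * m * y - w * y ^+ 2 <= r ^+ 2 * m ^+ 2 / w.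
Proof.
move=> w0; rewrite ler_pdivlMr // -subr_ge0.
rewrite (_ : _ - _ = (r * m - w * y) ^+ 2) ?sqr_ge0 //; ring.
Qed.

(** The entry is the sum of the [U j i ^+ 2 * d 0 j]; if it were zero, column [i] of [U] would
    vanish, against [U^T U = 1]. *)
Lemma conj_diag_diag_gt0 (R : realFieldType) (n : nat) (U : 'M[R]_n)
    (d : 'rV[R]_n) (i : 'I_n) :
  U *m U^T = 1%:M -> (forall j, 0 < d 0 j) ->
  0 < (U^T *m diag_mx d *m U) i i.
Proof.
move=> UU d0; rewrite !mxE.
under eq_bigr do rewrite mul_mx_diag !mxE mulrAC -expr2.
have Fge0 j : true -> 0 <= U j i ^+ 2 * d 0 j.
  by move=> _; rewrite mulr_ge0 ?sqr_ge0 // ltW.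
rewrite lt_neqAle sumr_ge0 // andbT; apply/eqP => /esym s00.
have U0 j : U j i = 0.
  have /eqP := @psumr_eq0P _ _ _ _ Fge0 s00 j isT.
  by rewrite mulf_eq0 sqrf_eq0 (gt_eqF (d0 j)) orbF => /eqP.
have := congr1 (fun N : 'M[R]_n => N i i) (mulmx1C UU).
rewrite !mxE eqxx big1 => [/esym/eqP|j _]; first by rewrite oner_eq0.
by rewrite U0 mulr0.
Qed.

(* Take the diagonal operator D with entries rho_i / (sig_i + t rho_i) and
   apply AM-GM to the matrix coefficients of D between the two eigenbases. *)
Lemma pinched_frac_le (R : realType) (n : nat) (P Q : 'M[R]_n)
    (r s : 'rV[R]_n) (t : R) :
  let rho := P^T *m diag_mx r *m P in let sig := Q^T *m diag_mx s *m Q in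
  let M := P *m Q^T in
  P *m P^T = 1%:M -> Q *m Q^T = 1%:M ->
  (forall j, 0 < r 0 j) -> (forall k, 0 < s 0 k) ->
  0 <= t ->
  \sum_i rho i i ^+ 2 / (sig i i + t * rho i i) <=
  \sum_j \sum_k M j k ^+ 2 * r 0 j ^+ 2 / (s 0 k + t * r 0 j).
Proof.
move=> rho sig M PP QQ r0 s0 t0.
have rho0 i : 0 < rho i i by exact: conj_diag_diag_gt0.
have sig0 i : 0 < sig i i by exact: conj_diag_diag_gt0.
pose d : 'rV[R]_n := \row_i (rho i i / (sig i i + t * rho i i)).
pose Y := P *m diag_mx d *m Q^T.
(* With D = [diag_mx d], the next three facts express Tr[rho D], Tr[rho D^2] and Tr[sig D^2] through
   the coefficients [Y] of D between the two eigenbases. *)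
have Y1 : \sum_j \sum_k r 0 j * (M j k * Y j k) = \sum_i d 0 i * rho i i.
  have := trace_diag_mul2 r (const_mx 1) M Y.
  under [X in _ = X -> _]eq_bigr do under eq_bigr do rewrite mxE mulr1.
  move=> <-; rewrite diag_const_mx mulmx1 /M /Y !trmx_mul trmxK tr_diag_mx.
  rewrite !mulmxA -(mulmxA _ Q^T) (mulmx1C QQ) mulmx1 mxtrace_mulC !mulmxA.
  rewrite mxtrace_mulC; apply: eq_bigr => i _.
  by rewrite -/rho mul_diag_mx mxE.
have Y2 : \sum_j \sum_k r 0 j * Y j k ^+ 2 = \sum_i d 0 i ^+ 2 * rho i i.
  have := trace_diag_mul2 r (const_mx 1) Y Y.
  under [X in _ = X -> _]eq_bigr do under eq_bigr do rewrite mxE mulr1 -expr2.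
  move=> <-; rewrite diag_const_mx mulmx1 /Y !trmx_mul trmxK tr_diag_mx.
  rewrite !mulmxA -(mulmxA _ Q^T) (mulmx1C QQ) mulmx1 mxtrace_mulC !mulmxA.
  apply: eq_bigr => i _.
  by rewrite -/rho mul_mx_diag mxE mul_mx_diag mxE; ring.
have Y3 : \sum_j \sum_k s 0 k * Y j k ^+ 2 = \sum_i d 0 i ^+ 2 * sig i i.
  have := trace_diag_mul2 (const_mx 1) s Y Y.
  under [X in _ = X -> _]eq_bigr do under eq_bigr do rewrite mxE mul1r -expr2.
  move=> <-; rewrite diag_const_mx mul1mx /Y !trmx_mul trmxK tr_diag_mx.
  rewrite !mulmxA mxtrace_mulC !mulmxA (mulmx1C PP) mul1mx; apply: eq_bigr => i _.
  by rewrite -!mulmxA mul_diag_mx mxE !mulmxA -/sig mul_mx_diag mxE; ring.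
(* The choice of [d] makes [2 d_i rho_ii - d_i^2 (sig_ii + t rho_ii)] equal to the [i]-th
   fraction. *)
have -> : \sum_i rho i i ^+ 2 / (sig i i + t * rho i i) =
    \sum_j \sum_k (2 * r 0 j * M j k * Y j k
      - (s 0 k + t * r 0 j) * Y j k ^+ 2).
  transitivity (2 * (\sum_j \sum_k r 0 j * (M j k * Y j k))
    - ((\sum_j \sum_k s 0 k * Y j k ^+ 2)
       + t * \sum_j \sum_k r 0 j * Y j k ^+ 2)).
    rewrite Y1 Y2 Y3 !mulr_sumr -big_split -sumrB; apply: eq_bigr => i _.
    have w0 : 0 < sig i i + t * rho i i.
      by rewrite ltr_pwDl // mulr_ge0 // ltW.
    have -> : d 0 i = rho i i / (sig i i + t * rho i i) by rewrite mxE.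
    by rewrite /=; field; rewrite gt_eqF.
  rewrite !mulr_sumr -big_split -sumrB; apply: eq_bigr => j _ /=.
  rewrite !mulr_sumr -big_split -sumrB; apply: eq_bigr => k _ /=.
  by ring.
apply: ler_sum => j _; apply: ler_sum => k _; rewrite [X in _ <= X / _]mulrC.
by apply: amgm_frac; rewrite ltr_pwDl // mulr_ge0 // ltW.
Qed.

(** [sum_ln_ge0] is applied on the disjoint union of the indices [i], with weights [- rho i i], and
    the pairs (j, k). The weights sum to 0 because both families count Tr rho. *)
Lemma pinched_entropy_le (R : realType) (n : nat) (P Q : 'M[R]_n)
    (r s : 'rV[R]_n) :
  let rho := P^T *m diag_mx r *m P in let sig := Q^T *m diag_mx s *m Q in
  let M := P *m Q^T in
  P *m P^T = 1%:M -> Q *m Q^T = 1%:M ->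
  (forall j, 0 < r 0 j) -> (forall k, 0 < s 0 k) ->
  \sum_i rho i i * (ln (rho i i) - ln (sig i i)) <=
  \sum_j \sum_k M j k ^+ 2 * r 0 j * (ln (r 0 j) - ln (s 0 k)).
Proof.
move=> rho sig M PP QQ r0 s0.
have rho0 i : 0 < rho i i by exact: conj_diag_diag_gt0.
have sig0 i : 0 < sig i i by exact: conj_diag_diag_gt0.
pose I := ('I_n + 'I_n * 'I_n)%type.
pose c (e : I) := match e with
  | inl i => - rho i i | inr p => M p.1 p.2 ^+ 2 * r 0 p.1 end.
pose x (e : I) := match e with inl i => sig i i | inr p => s 0 p.2 end.
pose y (e : I) := match e with inl i => rho i i | inr p => r 0 p.1 end.
have : 0 <= \sum_e c e * (ln (y e) - ln (x e)).
  apply: sum_ln_ge0 => [[i|[j k]]|[i|[j k]]||t t0] //=.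
  - rewrite big_sumType /= sumrN addrC; apply/eqP; rewrite subr_eq0; apply/eqP.
    have := trace_conj_diagl P r QQ; rewrite -/rho /mxtrace => ->.
    rewrite pair_bigA /=; apply: eq_bigr => p _; exact: mulrC.
  - have := pinched_frac_le PP QQ r0 s0 t0; rewrite -subr_ge0 pair_bigA /=.
    rewrite big_sumType /= addrC -sumrN => le; rewrite (le_trans le) //.
    rewrite le_eqVlt; apply/orP; left; apply/eqP; congr (_ + _).
      by apply: eq_bigr => p _; rewrite expr2 mulrA.
    by apply: eq_bigr => i _; rewrite expr2 !mulNr.
rewrite big_sumType /= addrC pair_bigA /= => le.
rewrite -subr_ge0 (le_trans le) // le_eqVlt; apply/orP; left; apply/eqP; congr (_ + _).
by rewrite -sumrN; apply: eq_bigr => i _; rewrite mulNr.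
Qed.

Lemma golden_thompson_diag (R : realType) (n : nat) (A : 'M[R]_n)
    (v : 'rV[R]_n) : A^T = A ->
  \tr (expm (A + diag_mx v)) <= \tr (expm (diag_mx v) *m expm A).
Proof.
move=> As.
have /sym_spectral[P [h [PP HE]]] : (A + diag_mx v)^T = A + diag_mx v.
  by rewrite linearD /= As tr_diag_mx.
have [Q [a [QQ AE]]] := sym_spectral As.
rewrite HE AE expm_diag !expm_conj_diag //.
set r := map_mx expR h; set s := map_mx expR a.
set rho := _ *m P; set sig := _ *m Q.
have r0 j : 0 < r 0 j by rewrite mxE expR_gt0.
have s0 j : 0 < s 0 j by rewrite mxE expR_gt0.
have rho0 i : 0 < rho i i by exact: conj_diag_diag_gt0.
have sig0 i : 0 < sig i i by exact: conj_diag_diag_gt0.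
have ent := pinched_entropy_le PP QQ r0 s0; rewrite -/rho -/sig in ent.
(* ln rho - ln sig = (A + D) - A = D, and Tr[rho D] involves only the diagonal of rho. *)
have relE : \sum_j \sum_k (P *m Q^T) j k ^+ 2 * r 0 j * (ln (r 0 j) - ln (s 0 k))
    = \sum_i rho i i * v 0 i.
  transitivity (\tr (rho *m (P^T *m diag_mx h *m P)) - \tr (rho *m A)).
    have -> : rho *m (P^T *m diag_mx h *m P) =
        P^T *m diag_mx (\row_j (r 0 j * h 0 j)) *m P.
      rewrite /rho !mulmxA -(mulmxA _ P) PP mulmx1 -(mulmxA P^T) mulmx_diag.
      by congr (_ *m diag_mx _ *m _); apply/rowP => j; rewrite !mxE.
    rewrite AE trace_conj_diag2 (trace_conj_diagl _ _ QQ).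
    rewrite -sumrB; apply: eq_bigr => j _; rewrite -sumrB; apply: eq_bigr => k _.
    by rewrite !mxE !expRK; ring.
  rewrite -linearB -mulmxBr -HE addrC addKr; apply: eq_bigr => i _.
  by rewrite mul_mx_diag mxE.
rewrite relE in ent.
have -> : \tr (diag_mx (map_mx expR v) *m sig) = \sum_i expR (v 0 i) * sig i i.
  by apply: eq_bigr => i _; rewrite mul_diag_mx !mxE.
rewrite -subr_le0 -sumrB; rewrite -subr_le0 -sumrB in ent.
apply: le_trans ent; apply: ler_sum => i _.
(* This is x ln (x / y) >= x - y with x = [rho i i] and y = [expR (v 0 i) * sig i i]. *)
have := expR_tangent_ge (v 0 i + ln (sig i i)) (ln (rho i i)).
rewrite expRD !lnK ?posrE //; lra.
Qed.

(** * The dual objective and its minorant *)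

Lemma scale_diag_mx (R : comNzRingType) (n : nat) (a : R) (d : 'rV[R]_n) :
  a *: diag_mx d = diag_mx (a *: d).
Proof. by rewrite linearZ. Qed.

Lemma X_diag_gt0 (R : realType) (n : nat) (beta : R) (C : 'M[R]_n)
    (l : 'rV[R]_n) (i : 'I_n) : C^T = C -> 0 < X beta C l i i.
Proof.
move=> Cs; rewrite /X; set H := - beta *: _.
have /sym_spectral[P [d [PP ->]]] : H^T = H.
  by rewrite /H !linearZ /= linearB /= Cs tr_diag_mx.
by rewrite expm_conj_diag //; apply: conj_diag_diag_gt0 => // j; rewrite mxE expR_gt0.
Qed.

Lemma scaled_shiftE (R : realType) (n : nat) (beta : R) (C : 'M[R]_n)
    (l l0 : 'rV[R]_n) :
  - beta *: (C - diag_mx l) =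
  - beta *: (C - diag_mx l0) + diag_mx (beta *: (l - l0)).
Proof.
apply/matrixP => i j; rewrite !mxE.
by case: (i == j); rewrite ?mulr1n ?mulr0n; ring.
Qed.

Lemma scaled_shift_sym (R : realType) (n : nat) (beta : R) (C : 'M[R]_n)
    (l : 'rV[R]_n) : C^T = C ->
  (- beta *: (C - diag_mx l))^T = - beta *: (C - diag_mx l).
Proof. by move=> Cs; rewrite !linearZ /= linearB /= Cs tr_diag_mx. Qed.

(** The minorant separates into functions of one coordinate each, which makes its concavity and its
    maximizer explicit. *)
Lemma g0E (R : realType) (n : nat) (beta : R) (C : 'M[R]_n)
    (b l0 l : 'rV[R]_n) :
  g0 beta C b l0 l = \sum_i (b 0 i * l 0 i -
    beta^-1 * (expR (beta * (l 0 i - l0 0 i)) * X beta C l0 i i)).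
Proof.
rewrite /g0 scale_diag_mx expm_diag sumrB -mulr_sumr; congr (_ - _ * _).
by apply: eq_bigr => i _; rewrite mul_diag_mx !mxE.
Qed.

Lemma g0_id (R : realType) (n : nat) (beta : R) (C : 'M[R]_n)
    (b l : 'rV[R]_n) : g0 beta C b l l = g beta C b l.
Proof.
rewrite g0E sumrB -mulr_sumr; congr (_ - _ * _); apply: eq_bigr => i _.
by rewrite subrr mulr0 expR0 mul1r.
Qed.

Lemma g0_le_g (R : realType) (n : nat) (beta : R) (C : 'M[R]_n)
    (b l0 l : 'rV[R]_n) : 0 < beta -> C^T = C ->
  g0 beta C b l0 l <= g beta C b l.
Proof.
move=> beta0 Cs; rewrite /g0 /g lerD2l lerN2 ler_pM2l ?invr_gt0 //.
rewrite (scaled_shiftE beta C l l0) scale_diag_mx.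
exact/golden_thompson_diag/scaled_shift_sym.
Qed.

(** Klein's inequality between the exponents at [l] and [l0]: they differ by a diagonal matrix, so
    the linear term sees only the diagonal of [X beta C l0]. The vector b - diag X(l0) plays the
    role of the gradient. *)
Lemma g_lt_tangent (R : realType) (n : nat) (beta : R) (C : 'M[R]_n)
    (b l0 l : 'rV[R]_n) : 0 < beta -> C^T = C -> l != l0 ->
  g beta C b l <
  g beta C b l0 + \sum_i (b 0 i - X beta C l0 i i) * (l 0 i - l0 0 i).
Proof.
move=> beta0 Cs ll0.
have rearrange (u v w p q : R) : p + w < q -> u - q < v - p + (u - v - w).
  by lra.
set A := - beta *: (C - diag_mx l0).
have HA : - beta *: (C - diag_mx l) - A = diag_mx (beta *: (l - l0)).
  by rewrite (scaled_shiftE beta C l l0) addrC addKr.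
have HA0 : - beta *: (C - diag_mx l) != A.
  rewrite -subr_eq0 HA; apply: contraNneq ll0 => /matrixP D0; apply/eqP/rowP => i.
  have /eqP := D0 i i; rewrite !mxE eqxx mulr1n mulf_eq0 gt_eqF //=.
  by rewrite subr_eq0 => /eqP.
have := trace_expm_tangent_gt (scaled_shift_sym beta l0 Cs)
  (scaled_shift_sym beta l Cs) HA0.
rewrite -/A HA -(@ltr_pM2l _ beta^-1) ?invr_gt0 // /g /dot => lt.
rewrite -/A.
have TE : beta^-1 * \tr (diag_mx (beta *: (l - l0)) *m expm A) =
    \sum_i X beta C l0 i i * (l 0 i - l0 0 i).
  rewrite mulr_sumr; apply: eq_bigr => i _; rewrite mul_diag_mx !mxE.
  by rewrite -/A; field; rewrite gt_eqF.
rewrite mulrDr TE in lt.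
have -> : \sum_i (b 0 i - X beta C l0 i i) * (l 0 i - l0 0 i) =
    \sum_i b 0 i * l 0 i - \sum_i b 0 i * l0 0 i
      - \sum_i X beta C l0 i i * (l 0 i - l0 0 i).
  by rewrite -!sumrB; apply: eq_bigr => i _; ring.
exact: rearrange lt.
Qed.

Lemma g_le_tangent (R : realType) (n : nat) (beta : R) (C : 'M[R]_n)
    (b l0 l : 'rV[R]_n) : 0 < beta -> C^T = C ->
  g beta C b l <=
  g beta C b l0 + \sum_i (b 0 i - X beta C l0 i i) * (l 0 i - l0 0 i).
Proof.
move=> beta0 Cs; have [->|/g_lt_tangent/ltW] := eqVneq l l0; last exact.
by rewrite big1 ?addr0 // => i _; rewrite subrr mulr0.
Qed.

(** Near [l0], [g] is squeezed between the minorant built at [l0] and the affine majorant. Both are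
    explicit in coordinates, continuous, and equal to [g] at [l0]. *)
Lemma g_continuous (R : realType) (n : nat) (beta : R) (C : 'M[R]_n)
    (b : 'rV[R]_n) : 0 < beta -> C^T = C -> continuous (g beta C b).
Proof.
move=> beta0 Cs; suff: forall l0 : 'rV[R]_n, g beta C b @ l0 --> g beta C b l0.
  exact.
move=> l0.
have ci i : (fun l : 'rV[R]_n => l 0 i) l @[l --> l0] --> l0 0 i.
  exact: coord_continuous.
have di i : (fun l : 'rV[R]_n => l 0 i - l0 0 i) l @[l --> l0]
    --> l0 0 i - l0 0 i.
  exact: cvgB (ci i) (cvg_cst _).
have ei i : (fun l : 'rV[R]_n => expR (beta * (l 0 i - l0 0 i))) l @[l --> l0]
    --> expR (beta * (l0 0 i - l0 0 i)).
  have bi : (fun l : 'rV[R]_n => beta * (l 0 i - l0 0 i)) l @[l --> l0]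
      --> beta * (l0 0 i - l0 0 i) by exact: cvgMl_tmp (di i).
  exact: cvg_comp bi (@continuous_expR R _).
have g0_cvg : g0 beta C b l0 l @[l --> l0] --> g beta C b l0.
  rewrite -(g0_id beta C b l0) (funext (g0E beta C b l0)).
  apply: (@cvg_big _ _ _ _ _ (@add_continuous _) _ (nbhs l0)) => i _.
  exact: cvgB (cvgMl_tmp (ci i)) (cvgMl_tmp (cvgMr_tmp (ei i))).
pose h (l : 'rV[R]_n) := g beta C b l0 +
  \sum_i (b 0 i - X beta C l0 i i) * (l 0 i - l0 0 i).
have h_cvg : h l @[l --> l0] --> g beta C b l0.
  have -> : g beta C b l0 = h l0.
    by rewrite /h big1 ?addr0 // => i _; rewrite subrr mulr0.
  have s_cvg : (fun l : 'rV[R]_n =>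
      \sum_i (b 0 i - X beta C l0 i i) * (l 0 i - l0 0 i)) l @[l --> l0] -->
      \sum_i (b 0 i - X beta C l0 i i) * (l0 0 i - l0 0 i).
    apply: (@cvg_big _ _ _ _ _ (@add_continuous _) _ (nbhs l0)) => i _.
    exact: cvgMl_tmp (di i).
  exact: cvgD (cvg_cst _) s_cvg.
apply: squeeze_cvgr g0_cvg h_cvg.
by apply: nearW => l; rewrite g0_le_g ?g_le_tangent.
Qed.

(** Average the tangent inequalities at the barycenter [m], with weights [t] and [1 - t]: the slope
    terms cancel. *)
Lemma expR_strictly_convex (R : realType) (t x y : R) :
  0 < t -> t < 1 -> x != y ->
  expR (t * x + (1 - t) * y) < t * expR x + (1 - t) * expR y.
Proof.
move=> t0 t1 xy; set m := t * x + (1 - t) * y.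
have t10 : 0 < 1 - t by rewrite subr_gt0.
have /expR_tangent_gt : x != m.
  rewrite -subr_eq0 (_ : x - m = (1 - t) * (x - y)); last by rewrite /m; ring.
  by rewrite mulf_neq0 // subr_eq0 // gt_eqF.
have := expR_tangent_ge y m.
rewrite -(ler_pM2l t10) -(ltr_pM2l t0) => ym xm.
apply: le_lt_trans (ltr_leD xm ym).
rewrite le_eqVlt; apply/orP; left; apply/eqP.
by move: (expR m) => e; rewrite /m; ring.
Qed.

Lemma g0_concave (R : realType) (n : nat) (beta : R) (C : 'M[R]_n)
    (b l0 : 'rV[R]_n) : 0 < beta -> C^T = C ->
  strictly_concave (g0 beta C b l0).
Proof.
move=> beta0 Cs x y t xy t0 t1; rewrite !g0E !mulr_sumr -big_split /=.
(* Recording the equality case in each coordinate makes the sum strict as soon as [x] and [y] differ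
   in one of them. *)
have term i : t * (b 0 i * x 0 i -
      beta^-1 * (expR (beta * (x 0 i - l0 0 i)) * X beta C l0 i i)) +
    (1 - t) * (b 0 i * y 0 i -
      beta^-1 * (expR (beta * (y 0 i - l0 0 i)) * X beta C l0 i i)) <=
    b 0 i * (t *: x + (1 - t) *: y) 0 i -
      beta^-1 * (expR (beta * ((t *: x + (1 - t) *: y) 0 i - l0 0 i)) *
      X beta C l0 i i) ?= iff (x 0 i == y 0 i).
  have := X_diag_gt0 beta l0 i Cs.
  move: (X _ _ _ _ _) => w w0; rewrite !mxE.
  move: (x 0 i) (y 0 i) (l0 0 i) (b 0 i) => u v z c.
  rewrite (_ : beta * (t * u + (1 - t) * v - z) =
      t * (beta * (u - z)) + (1 - t) * (beta * (v - z)));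
    last by ring.
  apply/leifP; have [->|uv] := eqVneq u v.
    have -> : t * (beta * (v - z)) + (1 - t) * (beta * (v - z)) = beta * (v - z).
      by ring.
    by apply/eqP; ring.
  have /(expR_strictly_convex t0 t1) : beta * (u - z) != beta * (v - z).
    rewrite -subr_eq0 (_ : _ - _ = beta * (u - v)); last by ring.
    by rewrite mulf_neq0 ?subr_eq0 // gt_eqF.
  move: (expR _) (expR _) (expR _) => q p m lt.
  rewrite -subr_gt0.
  rewrite (_ : _ - _ = beta^-1 * w * (t * p + (1 - t) * q - m)); last by ring.
  by rewrite mulr_gt0 ?subr_gt0 // mulr_gt0 ?invr_gt0.
rewrite (lt_leif (leif_sum (fun i _ => term i))).
apply: contra xy => /forallP xy; apply/eqP/rowP => i.
exact/eqP/(implyP (xy i)).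
Qed.

(* exp(beta (l1_i - l0_i)) X(l0)_ii = b_i turns each coordinate of g0 into
   b_i (x - exp(beta (x - l1_i)) / beta), maximal exactly at x = l1_i. *)
Lemma g0_lt_update (R : realType) (n : nat) (beta : R) (C : 'M[R]_n)
    (b l0 l : 'rV[R]_n) : 0 < beta -> C^T = C -> (forall i, 0 < b 0 i) ->
  l != scaling_update beta C b l0 ->
  g0 beta C b l0 l < g0 beta C b l0 (scaling_update beta C b l0).
Proof.
move=> beta0 Cs b0; set l1 := scaling_update _ _ _ _ => ll1; rewrite !g0E.
have l1E i x : expR (beta * (x - l0 0 i)) * X beta C l0 i i =
    b 0 i * expR (beta * (x - l1 0 i)).
  have s0 := X_diag_gt0 beta l0 i Cs.
  rewrite -{1}(lnK (s0 : X beta C l0 i i \is Num.pos)).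
  rewrite -{1}(lnK (b0 i : b 0 i \is Num.pos)) -!expRD; congr expR.
  by rewrite !mxE; field; rewrite gt_eqF.
have term i : b 0 i * l 0 i -
    beta^-1 * (expR (beta * (l 0 i - l0 0 i)) * X beta C l0 i i) <=
    b 0 i * l1 0 i -
    beta^-1 * (expR (beta * (l1 0 i - l0 0 i)) * X beta C l0 i i)
    ?= iff (l 0 i == l1 0 i).
  rewrite !l1E subrr mulr0 expR0; apply/leifP.
  have [->|ne] := eqVneq; first by rewrite subrr mulr0 expR0.
  have /expR_gt1Dx : beta * (l 0 i - l1 0 i) != 0.
    by rewrite mulf_neq0 ?subr_eq0 // gt_eqF.
  move: (b0 i); move: (b 0 i) (l 0 i) (l1 0 i) (expR _) => c u v e c0 lt.
  rewrite -subr_gt0.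
  rewrite (_ : _ - _ = beta^-1 * c * (e - (1 + beta * (u - v)))); last first.
    by field; rewrite gt_eqF.
  by rewrite mulr_gt0 ?subr_gt0 // mulr_gt0 ?invr_gt0.
rewrite (lt_leif (leif_sum (fun i _ => term i))).
apply: contra ll1 => /forallP ll1; apply/eqP/rowP => i.
exact/eqP/(implyP (ll1 i)).
Qed.

(** * Coercivity of the dual objective and existence of a maximizer *)

(** Klein's inequality between the exponent and its diagonal part [diag_mx d]: their difference has
    zero diagonal and exp of the diagonal part is diagonal, so the linear term vanishes. *)
Lemma g_le_diag (R : realType) (n : nat) (beta : R) (C : 'M[R]_n)
    (b l : 'rV[R]_n) : 0 < beta -> C^T = C ->
  g beta C b l <=
  \sum_i (b 0 i * l 0 i - beta^-1 * expR (beta * (l 0 i - C i i))).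
Proof.
move=> beta0 Cs; rewrite sumrB -mulr_sumr lerD2l lerN2 ler_pM2l ?invr_gt0 //.
set H := - beta *: _.
pose d := \row_i (beta * (l 0 i - C i i)).
have := trace_expm_tangent_ge (tr_diag_mx d) (scaled_shift_sym beta l Cs).
rewrite -/H expm_diag.
rewrite [X in _ + X]big1 => [|i _]; last first.
  by rewrite mul_mx_diag !mxE eqxx !mulr1n; ring.
rewrite addr0; apply: le_trans; rewrite le_eqVlt; apply/orP; left; apply/eqP.
by apply: eq_bigr => i _; rewrite !mxE eqxx mulr1n.
Qed.

(** Replacing the exponential term by its tangent of slope [a] bounds the function by
    [(b - a) * x + k a]. The slopes [b / 2] for [x < 0] and [3 * b / 2] for [x >= 0] both leave
    [- b / 2 * |x|]. *)
Lemma linear_sub_expR_coercive (R : realType) (b beta c : R) :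
  0 < b -> 0 < beta -> exists K, forall x,
  b * x - beta^-1 * expR (beta * (x - c)) <= K - b / 2 * `|x|.
Proof.
move=> b0 beta0; pose k a := a * c + beta^-1 * a * (ln a - 1).
have lin a x : 0 < a ->
    b * x - beta^-1 * expR (beta * (x - c)) <= (b - a) * x + k a.
  move=> a0; have := expR_tangent_ge (beta * (x - c)) (ln a).
  rewrite lnK // -(ler_pM2l (_ : 0 < beta^-1)) ?invr_gt0 // => le.
  rewrite -lerBlDl -subr_ge0; rewrite -subr_ge0 in le; apply: le_trans le _.
  rewrite le_eqVlt; apply/orP; left; apply/eqP.
  by rewrite /k; field; rewrite gt_eqF.
exists (`|k (b / 2)| + `|k (3 * b / 2)|) => x.
have b1 : 0 < b / 2 by lra.
have b2 : 0 < 3 * b / 2 by lra.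
have := lin _ x b1; have := lin _ x b2.
have := ler_norm (k (b / 2)); have := ler_norm (k (3 * b / 2)).
have := normr_ge0 (k (b / 2)); have := normr_ge0 (k (3 * b / 2)).
move: (k _) (k _) `|k _| `|k _| (beta^-1 * expR _) => k1 k2 n1 n2 e.
by case: (lerP 0 x) => x0; rewrite ?(ger0_norm x0) ?(ltr0_norm x0); lra.
Qed.

Lemma g_superlevel_bounded (R : realType) (n : nat) (beta : R) (C : 'M[R]_n)
    (b l0 : 'rV[R]_n) : 0 < beta -> C^T = C -> (forall i, 0 < b 0 i) ->
  exists B, forall l, g beta C b l0 <= g beta C b l -> forall i, `|l 0 i| <= B.
Proof.
move=> beta0 Cs b0.
have /boolp.choice[K K_le] : forall i, exists K, forall x,
    b 0 i * x - beta^-1 * expR (beta * (x - C i i)) <= K - b 0 i / 2 * `|x|.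
  by move=> i; exact: linear_sub_expR_coercive.
pose S := \sum_i K i - g beta C b l0.
have weighted l : g beta C b l0 <= g beta C b l -> \sum_i b 0 i / 2 * `|l 0 i| <= S.
  move=> le; rewrite lerBrDl -lerBrDr -sumrB.
  apply: le_trans le (le_trans (g_le_diag b l beta0 Cs) _).
  by apply: ler_sum => i _; exact: K_le.
have pos (l : 'rV[R]_n) i : 0 <= b 0 i / 2 * `|l 0 i|.
  by rewrite mulr_ge0 // divr_ge0 // ltW.
(* Coordinate [i] is bounded by [(b 0 i / 2)^-1 * S]; summing these nonnegative bounds gives one
   that is uniform in [i]. *)
exists (\sum_i (b 0 i / 2)^-1 * S) => l /weighted le i.
have S0 : 0 <= S by apply: le_trans le; apply: sumr_ge0.
apply: (@le_trans _ _ ((b 0 i / 2)^-1 * S)).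
  rewrite ler_pdivlMl ?divr_gt0 //; apply: le_trans le.
  by rewrite (bigD1 i) //= lerDl sumr_ge0.
rewrite [leRHS](bigD1 i) //= lerDl sumr_ge0 // => j _.
by rewrite mulr_ge0 // invr_ge0 divr_ge0 // ltW.
Qed.

(** The superlevel set through 0 is compact and nonempty, and a maximizer on it is global because
    [g] is below [g 0] elsewhere. *)
Lemma g_has_max (R : realType) (n : nat) (beta : R) (C : 'M[R]_n)
    (b : 'rV[R]_n) : 0 < beta -> C^T = C -> (forall i, 0 < b 0 i) ->
  exists lstar, argmax (g beta C b) lstar.
Proof.
move=> beta0 Cs b0; pose A := g beta C b @^-1` [set x | g beta C b 0 <= x].
have gc : continuous (g beta C b) by exact: g_continuous.
have [B AB] := g_superlevel_bounded 0 beta0 Cs b0.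
have cA : compact A.
  apply: bounded_closed_compact.
    exists `|B|; split; first exact: num_real.
    (* The norm is a maximum of absolute values with default 0, so its bound must be nonnegative;
       hence [|B|] rather than [B]. *)
    move=> M BM l Al; rewrite /= -[`|l|]/(mx_norm l) mx_normrE.
    apply/bigmax_leP; split=> [|[i j] _] /=.
      by rewrite ltW // (le_lt_trans (normr_ge0 B)).
    by rewrite ord1 (le_trans (AB l Al j)) // ltW // (le_lt_trans (ler_norm B)).
  by apply: preimage_closed => [l _|]; [exact: gc|exact: closed_ge].
have A0 : A !=set0 by exists 0; rewrite /A /=.
have [lstar /set_mem Al max] := EVT_max_rV A0 cA (continuous_subspaceT gc).
exists lstar => l /=.
have /orP[Al'|le] := le_total (g beta C b 0) (g beta C b l).
  by apply: max; exact/mem_set.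
exact: le_trans le Al.
Qed.

(** * Fixed points of the update and the minorize-maximize argument *)

(** At a fixed point diag X = b, so the slope in the strict tangent inequality is zero. *)
Lemma fixed_update_lt (R : realType) (n : nat) (beta : R) (C : 'M[R]_n)
    (b l0 l : 'rV[R]_n) : 0 < beta -> C^T = C -> (forall i, 0 < b 0 i) ->
  scaling_update beta C b l0 = l0 -> l != l0 -> g beta C b l < g beta C b l0.
Proof.
move=> beta0 Cs b0 fix0 /(g_lt_tangent b beta0 Cs).
rewrite [X in _ + X]big1 ?addr0 // => i _.
have /eqP : ln (b 0 i) - ln (X beta C l0 i i) = 0.
  move/rowP/(_ i): fix0; rewrite !mxE => /(canRL (addKr _)).
  by rewrite addNr => /eqP; rewrite mulf_eq0 invr_eq0 gt_eqF //= => /eqP.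
rewrite subr_eq0 => /eqP/ln_inj ->; first by rewrite subrr mul0r.
  exact: b0.
exact: X_diag_gt0.
Qed.

(** If [upd x] differs from [x], then [f x = m x x < m x (upd x) <= f (upd x)], so a maximizer of
    [f] is fixed. Conversely a fixed point is a strict maximizer, hence unique. *)
Lemma minorize_maximize (R : realType) (T : eqType) (f : T -> R)
    (m : T -> T -> R) (upd : T -> T) :
  (forall x y, m x y <= f y) -> (forall x, m x x = f x) ->
  (forall x y, y != upd x -> m x y < m x (upd x)) ->
  (forall x y, upd x = x -> y != x -> f y < f x) ->
  (exists x, argmax f x) ->
  exists xstar, argmax f = [set xstar] /\
  forall x, [/\ argmax (m x) = [set upd x], upd x = x <-> x = xstar &
    f x <= f (upd x) /\ (x <> xstar -> f x < f (upd x))].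
Proof.
move=> m_le m_id m_upd fixed_gt [xstar xstar_max].
have max_fixed x : argmax f x -> upd x = x.
  move=> xmax; apply/eqP; apply: contraT; rewrite eq_sym => /m_upd.
  by rewrite m_id ltNge (le_trans (m_le _ _) (xmax _)).
have fixed_eq x : upd x = x -> x = xstar.
  move=> /fixed_gt xmax; apply/eqP; apply: contraT; rewrite eq_sym => /xmax.
  by rewrite ltNge xstar_max.
have upd_fixed x : upd x = x <-> x = xstar.
  by split=> [/fixed_eq //|->]; exact: max_fixed.
have upd_gt x : x != upd x -> f x < f (upd x).
  by move=> /m_upd; rewrite m_id => /lt_le_trans; apply.
exists xstar; split.
  by apply/seteqP; split=> [x /max_fixed/fixed_eq //|x ->].
move=> x; split => //.
- apply/seteqP; split=> [y ymax|_ -> y].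
    by apply/eqP; apply: contraT => /m_upd; rewrite ltNge ymax.
  by have [->|/m_upd/ltW] := eqVneq y (upd x).
- split=> [|ne]; first by have [<-|/upd_gt/ltW] := eqVneq x (upd x).
  by apply: upd_gt; apply: contra_not_neq ne => e; apply/upd_fixed.
Qed.

Theorem mainTheorem3 (R : realType) (n : nat) (beta : R) (C : 'M[R]_n)
    (b : 'rV[R]_n) (n_ge1 : (1 <= n)%N) (beta_gt0 : 0 < beta)
    (C_sym : C^T = C) (b_gt0 : forall i : 'I_n, 0 < b 0 i) :
  exists lstar : 'rV[R]_n, argmax (g beta C b) = [set lstar] /\
  forall l0 : 'rV[R]_n,
    let l1 := scaling_update beta C b l0 in
    [/\ strictly_concave (g0 beta C b l0),
        (forall l : 'rV[R]_n, g0 beta C b l0 l <= g beta C b l) /\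
          g0 beta C b l0 l0 = g beta C b l0,
        argmax (g0 beta C b l0) = [set l1],
        l1 = l0 <-> l0 = lstar &
        g beta C b l0 <= g beta C b l1 /\
          (l0 <> lstar -> g beta C b l0 < g beta C b l1)].
Proof.
have [lstar [gmax steps]] := minorize_maximize
  (fun l0 l => g0_le_g b l0 l beta_gt0 C_sym) (g0_id beta C b)
  (fun l0 l => @g0_lt_update R n beta C b l0 l beta_gt0 C_sym b_gt0)
  (fun l0 l => @fixed_update_lt R n beta C b l0 l beta_gt0 C_sym b_gt0)
  (g_has_max beta_gt0 C_sym b_gt0).
exists lstar; split; first exact: gmax.
move=> l0 l1; have [amax fixed incr] := steps l0; apply: And5.
- exact: g0_concave.
- by split; [move=> l; exact: g0_le_g|exact: g0_id].
- exact: amax.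
- exact: fixed.
- exact: incr.
Qed.
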